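(* Let $l\ge 2$, $q=1(l+1)l\ldots 2$, and write $M_j=M_{j,q}$. For $n\ge 2$ let $k_n$ be the largest integer $k\in\{1,\ldots,n-1\}$ maximizing $M_k+k\binom{n-k}{l}$. Then $k_n\to\infty$ as $n\to\infty$, and $$k_n\le k_{n+1}\le k_n+1\quad\text{for all } n\ge l+1.$$ Consequently, since $k_{l+1}=1$, for every positive integer $k$ there is a positive integer $n$ with $k_n=k$.
   Context: $q=1(l+1)l\ldots2$ is the permutation of length $l+1$ with first entry $1$ followed by $l+1,l,\ldots,2$. For $p\in S_n$, $c_q(p)$ is the number of subsequences of $p$ of length $l+1$ whose entries are in the same relative order as $q$, and $M_{n,q}=\max_{p\in S_n}c_q(p)$ (so $M_j=0$ for $j\le l$). *)

(* Defs.v *)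
From mathcomp Require Import all_boot all_fingroup.

Set Implicit Arguments.
Unset Strict Implicit.
Unset Printing Implicit Defensive.

(* A permutation p : 'S_n stands for the word p_1 ... p_n, with positions and
   entries both shifted down by one: p i is the entry at position i. *)

(* A subsequence of length m is given by its positions, i.e., by a strictly
   increasing f : 'I_m -> 'I_n. *)
Definition occurrences (m n : nat) (q : 'S_m) (p : 'S_n) :
    {set {ffun 'I_m -> 'I_n}} :=
  [set f : {ffun 'I_m -> 'I_n} |
    [forall i : 'I_m, forall j : 'I_m, (i < j) ==> (f i < f j)] &&
    [forall i : 'I_m, forall j : 'I_m,
      (p (f i) < p (f j)) == (q i < q j)]].

Definition pattern_count (m n : nat) (q : 'S_m) (p : 'S_n) : nat :=
  #|occurrences q p|.

Definition max_count (m n : nat) (q : 'S_m) : nat :=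
  \max_(p : 'S_n) pattern_count q p.

(* 1 (l+1) l ... 2, which is 0 l (l-1) ... 1 after the shift. *)
Definition q_fun (l : nat) (i : 'I_l.+1) : 'I_l.+1 :=
  if i == ord0 then ord0 else inord (l.+1 - i).

Lemma q_fun_inj (l : nat) : injective (@q_fun l).
Proof.
have val_q (i : 'I_l.+1) : i != ord0 -> q_fun i = l.+1 - i :> nat.
  move=> i0; rewrite /q_fun (negPf i0) inordK // ltn_subrL /= andbT lt0n.
  exact: i0.
have q_gt0 (i : 'I_l.+1) : i != ord0 -> q_fun i != ord0.
  by move=> i0; rewrite -val_eqE /= val_q // subn_eq0 -ltnNge ltn_ord.
move=> i j; have [->|i0] := eqVneq i ord0; have [->|j0] := eqVneq j ord0 => //.
- by move=> e; have := q_gt0 j j0; rewrite -e /q_fun eqxx.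
- by move=> e; have := q_gt0 i i0; rewrite e /q_fun eqxx.
move=> /(congr1 val) /=; rewrite !val_q // => e; apply: val_inj => /=.
by rewrite -(subKn (ltnW (ltn_ord i))) e subKn // ltnW.
Qed.

Definition q_perm (l : nat) : 'S_l.+1 := perm (@q_fun_inj l).

Definition M (l n : nat) : nat := max_count n (q_perm l).

Definition objective (l n k : nat) : nat := M l k + k * 'C(n - k, l).

Definition is_maximizer (l n k : nat) : bool :=
  (0 < k < n) && [forall j : 'I_n, (0 < j) ==> (objective l n j <= objective l n k)].

(* Meaningful for n >= 2 only: there is no candidate k for n <= 1, and then
   the value is 0. *)
Definition k_ (l n : nat) : nat := \max_(k < n | is_maximizer l n k) k.

(* Main.v *)
Require Import Defs.
From mathcomp Require Import all_boot all_fingroup zify.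

(* An occurrence of [q] is a point together with an antichain of size [l] above
   it, for the order of the points of the plot of [p]. In any finite poset all
   the maximal points can be turned into twins of a suitable one of them without
   losing occurrences (Zykov symmetrization). This increases the number of
   maximal points unless every other point lies below them, whence
   [M n = max_k (M k + k * 'C(n - k, l))].

   Let [f n k] be the objective. Writing an optimal word as a lower part of size
   [i] followed by two layers, exchanging these layers or moving one point
   between them shows that a maximizer [k] satisfies [l * k <= n + 1]. In this
   range [f (n + 1) j - f n j = j * 'C(n - j, l - 1)] increases with [j], hence
   [k_n <= k_(n+1)]. On the other hand
   [f (n + 1) (j + 1) - f n j = M (j + 1) - M j + 'C(n - j, l)] decreases with
   [j], by a bound on the second difference of [M] that is proved together with
   [k_(n+1) <= k_n + 1]. *)

Set Implicit Arguments.
Unset Strict Implicit.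
Unset Printing Implicit Defensive.

(** * Stars in finite posets *)


(** As [s * 'C(x, s) = x * 'C(x.-1, s.-1)], the ratio ['C(x, s) / x] is nondecreasing in [x]. *)
Lemma leq_mul_bin (m r s : nat) : 0 < s -> m <= r -> r * 'C(m, s) <= m * 'C(r, s).
Proof.
case: s => // s _ le_mr; rewrite -(leq_pmul2l (ltn0Sn s)) !(mulnCA s.+1).
rewrite -!mul_bin_diag mulnCA !(leq_mul2l, leq_mul2r).
by rewrite leq_bin2l ?orbT // -!subn1 leq_sub2r.
Qed.

Lemma ltn_mul_bin (m r s : nat) :
  1 < s -> s <= r -> 0 < m < r -> r * 'C(m, s) < m * 'C(r, s).
Proof.
case: s m r => [|[|s]] // [|m] [|r] // _ le_sr lt_mr.
rewrite -(ltn_pmul2l (ltn0Sn s.+1)) !(mulnCA s.+2) -!mul_bin_diag mulnCA.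
rewrite !ltn_pmul2l //=.
case: r le_sr lt_mr => // r le_sr lt_mr.
have : 'C(m, s.+1) <= 'C(r, s.+1) by apply: leq_bin2l; lia.
have : 0 < 'C(r, s) by rewrite bin_gt0; lia.
by rewrite binS; lia.
Qed.

Section Stars.

Variables (T : finType) (l : nat).
Implicit Types (e : rel T) (D X A B S : {set T}) (v x y z : T).

Definition antichain e A := [forall x in A, forall y in A, ~~ e x y].

(** The relation lives on all of [T] and only [D] varies, so that inductions can delete points
    without subtypes. *)
Definition stars e D : {set T * {set T}} :=
  [set w : T * {set T} | [&& w.1 \in D, w.2 \subset D, #|w.2| == l, antichain e w.2
             & [forall x in w.2, e w.1 x]]].

Definition maximals e D := [set x in D | [forall y in D, ~~ e x y]].

Lemma antichainP e A :
  reflect (forall x y, x \in A -> y \in A -> e x y = false) (antichain e A).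
Proof.
apply: (iffP forall_inP) => [H x y xA yA | H x xA].
  by apply: negbTE; have /forall_inP := H x xA; apply.
by apply/forall_inP => y yA; rewrite H.
Qed.

Lemma starsP e D z A :
  reflect [/\ z \in D, A \subset D, #|A| = l,
              forall x y, x \in A -> y \in A -> e x y = false
            & forall x, x \in A -> e z x]
          ((z, A) \in stars e D).
Proof.
rewrite inE /=; apply: (iffP and5P) => -[zD AD cA acA eA]; split => //.
- exact/eqP.
- exact/antichainP.
- exact/forall_inP.
- exact/eqP.
- exact/antichainP.
- exact/forall_inP.
Qed.

Lemma maximalsP e D x :
  reflect (x \in D /\ forall y, y \in D -> e x y = false) (x \in maximals e D).
Proof.
rewrite inE; apply: (iffP andP) => -[xD H]; split => //.
  by move=> y yD; apply: negbTE; apply: (forall_inP H).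
by apply/forall_inP => y yD; rewrite H.
Qed.

Lemma exists_maximal e A x :
  irreflexive e -> transitive e -> x \in A ->
  exists2 m, m \in A & forall y, y \in A -> e m y = false.
Proof.
move=> e_irr e_tr xA.
(* Take a point with the most predecessors; a point of [A] above it would have more. *)
case: (@arg_maxnP _ x (mem A) (fun m => #|[set y | e y m]|) xA) => m mA max_m.
exists m => // y yA; apply/negP => e_my.
suff /proper_card : [set t | e t m] \proper [set t | e t y].
  by move=> lt_card; have := leq_trans lt_card (max_m y yA); rewrite ltnn.
rewrite properE; apply/andP; split.
  by apply/subsetP => t; rewrite !inE => /e_tr; apply.
by apply/subsetPn; exists m; rewrite inE ?e_irr.
Qed.

(** What is left of a star once its leaves in [X] are erased; used with [D :\: X] in place of
    [D]. *)
Definition core e D (w : T * {set T}) :=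
  [&& w.1 \in D, w.2 \subset D, #|w.2| <= l, antichain e w.2
    & [forall x in w.2, e w.1 x]].

Definition extenders e X (w : T * {set T}) :=
  [set x in X | e w.1 x & [forall y in w.2, ~~ e y x]].

(** Stars are grouped by core. As [0 < l], a maximal point is never a centre; the points of [X] are
    pairwise incomparable with nothing of [D] above them, so any [l - #|w.2|] extenders complete
    [w]. *)
Lemma card_stars_core e D X :
  0 < l -> X \subset maximals e D ->
  #|stars e D| =
    \sum_(w | core e (D :\: X) w) 'C(#|extenders e X w|, l - #|w.2|).
Proof.
move=> l_gt0 /subsetP XM.
have XD x : x \in X -> x \in D by move=> /XM/maximalsP[].
have Xmax x y : x \in X -> y \in D -> e x y = false.
  by move=> /XM/maximalsP[_]; apply.
rewrite -sum1_card.
rewrite (partition_big (fun w => (w.1, w.2 :\: X)) (core e (D :\: X))) /=; last first.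
  case=> z A /starsP[zD AD cA acA eA]; apply/and5P; split => /=.
  - rewrite inE zD andbT; apply/negP => zX.
    have /card_gt0P[x xA] : 0 < #|A| by rewrite cA.
    by have := eA x xA; rewrite Xmax // (subsetP AD).
  - exact: setSD.
  - by rewrite -cA subset_leq_card ?subsetDl.
  - by apply/antichainP => x y /setDP[xA _] /setDP[yA _]; apply: acA.
  - by apply/forall_inP => x /setDP[/eA].
apply: eq_bigr => -[z B] /and5P[/= /setDP[zD zX] BD cB /antichainP acB /forall_inP eB].
have BX x : x \in B -> x \notin X by move=> /(subsetP BD)/setDP[].
have BD' x : x \in B -> x \in D by move=> /(subsetP BD)/setDP[].
rewrite sum1_card -cards_draws.
set draws := [set S | _ & _].
have injU : {in draws &, injective (fun S => (z, B :|: S))}.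
  move=> S1 S2 /setIdP[/subsetP sS1 _] /setIdP[/subsetP sS2 _] [] /setP eqU.
  apply/setP => x; have := eqU x; rewrite !in_setU.
  have [xB|//] := boolP (x \in B) => _.
  by apply/idP/idP => [/sS1|/sS2]; rewrite inE (negPf (BX x xB)).
rewrite -(card_in_imset injU); apply: eq_card => -[z' A].
rewrite -topredE /=; apply/andP/imsetP.
  case=> /starsP[_ AD cA acA eA] /eqP[ez AB]; subst z' B.
  have eqA : A = (A :\: X) :|: (A :&: X) by rewrite setUC setID.
  exists (A :&: X); last by rewrite -eqA.
  rewrite inE; apply/andP; split; last first.
    by rewrite -cA -(cardsID X A) addnK.
  apply/subsetP => x /setIP[xA xX]; rewrite !inE xX eA //=.
  by apply/forall_inP => y /setDP[yA _]; rewrite acA.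
case=> S /setIdP[/subsetP sS /eqP cS] [-> ->].
have SX x : x \in S -> x \in X by move=> /sS; rewrite inE => /andP[].
have zS x : x \in S -> e z x by move=> /sS; rewrite inE => /and3P[].
have BS x y : x \in S -> y \in B -> e y x = false.
  move=> /sS; rewrite inE => /and3P[_ _ /forall_inP H] yB.
  by apply: negbTE; apply: H.
have BS0 : B :&: S = set0.
  by apply/setP => x; rewrite !inE; apply/negP => /andP[/BX/negP h /SX].
split; last first.
  rewrite /= setDUl; apply/eqP; congr (_, _); apply/setP => x; rewrite !inE.
  have [/BX-> //|_] := boolP (x \in B).
  by have [/SX->|_] := boolP (x \in S); rewrite ?andbF.
apply/starsP; split=> //.
- by apply/subsetP => x /setUP[/BD'|/SX/XD].
- by rewrite cardsU BS0 cards0 cS subn0 subnKC.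
- move=> x y /setUP[xB|xS] /setUP[yB|yS]; [exact: acB|exact: BS| |].
    by rewrite Xmax ?SX ?BD'.
  by rewrite Xmax ?SX // XD ?SX.
- by move=> x /setUP[/eB|/zS].
Qed.

(** All points of [X] become twins of [v]. As a pullback of [e], the new relation inherits
    irreflexivity and transitivity. *)
Definition collapse e X v := relpre (fun x => if x \in X then v else x) e.

Lemma collapse_irr e X v : irreflexive e -> irreflexive (collapse e X v).
Proof. by move=> e_irr x /=. Qed.

Lemma collapse_tr e X v : transitive e -> transitive (collapse e X v).
Proof. by move=> e_tr y x z /=; apply: e_tr. Qed.

Lemma maximals_collapse e D v :
  v \in maximals e D -> maximals e D \subset maximals (collapse e (maximals e D) v) D.
Proof.
move=> vM; have /maximalsP[vD vmax] := vM.
apply/subsetP => x xM; apply/maximalsP; split=> [|y yD].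
  by case/maximalsP: xM.
by rewrite /collapse /= xM vmax //; case: ifP.
Qed.

Lemma core_collapse e D X v : core (collapse e X v) (D :\: X) =1 core e (D :\: X).
Proof.
case=> z B; rewrite /core /=.
have [/setDP[_ /negPf zX]|] //= := boolP (z \in _).
have [/subsetP BD|] //= := boolP (B \subset _).
have BX x : x \in B -> (x \in X) = false by move=> /BD/setDP[_ /negPf].
congr [&& _, _ & _].
  rewrite /antichain; apply: eq_forallb_in => x xB.
  by apply: eq_forallb_in => y yB; rewrite /collapse /= !BX.
by apply: eq_forallb_in => x xB; rewrite /collapse /= zX BX.
Qed.

Lemma extenders_collapse e D X v w :
  v \in X -> core e (D :\: X) w ->
  extenders (collapse e X v) X w = if v \in extenders e X w then X else set0.
Proof.
case: w => z B vX /and5P[/= /setDP[_ /negPf zX] /subsetP BD _ _ _].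
have BX x : x \in B -> (x \in X) = false by move=> /BD/setDP[_ /negPf].
have same x : x \in X ->
    (x \in extenders (collapse e X v) X (z, B)) = (v \in extenders e X (z, B)).
  move=> xX; rewrite !inE /collapse /= xX vX zX; congr (e z v && _).
  by apply: eq_forallb_in => y yB; rewrite BX.
apply/setP => x; have [xX|xX] := boolP (x \in X).
  by rewrite same //; case: ifP; rewrite ?xX ?inE.
by rewrite inE (negPf xX); case: ifP; rewrite ?(negPf xX) ?inE.
Qed.

(* Averaging over [v]: a core with [g] extenders in [X] and [s] missing points
   counts ['C(g, s)] times for [e], and on average [g / #|X| * 'C(#|X|, s)]
   times for the collapsed orders. *)
Lemma exists_collapse e D x :
  0 < l -> x \in maximals e D ->
  exists2 v, v \in maximals e D &
    #|stars e D| <= #|stars (collapse e (maximals e D) v) D|.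
Proof.
set X := maximals e D => l_gt0 xX.
case: (@arg_maxnP _ x (mem X) (fun v => #|stars (collapse e X v) D|) xX) => v vX max_v.
exists v => //; have X_gt0 : 0 < #|X| by apply/card_gt0P; exists x.
rewrite -(leq_pmul2l X_gt0) -[in X in _ <= X]sum_nat_const.
apply: (@leq_trans (\sum_(u in X) #|stars (collapse e X u) D|)); last exact: leq_sum.
have -> : \sum_(u in X) #|stars (collapse e X u) D| =
    \sum_(u in X) \sum_(w | core e (D :\: X) w)
       'C(if u \in extenders e X w then #|X| else 0, l - #|w.2|).
  apply: eq_bigr => u uX; rewrite (card_stars_core l_gt0 (maximals_collapse uX)).
  rewrite (eq_bigl _ _ (core_collapse e D X u)); apply: eq_bigr => w cw.
  by rewrite (extenders_collapse uX cw) (fun_if (fun A => #|A|)) cards0.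
rewrite (card_stars_core l_gt0 (subxx X)) exchange_big big_distrr /=.
apply: leq_sum => w _; set G := extenders e X w.
have GX : G \subset X by apply/subsetP => u; rewrite inE => /andP[].
case: (posnP (l - #|w.2|)) => [->|s_gt0].
  by rewrite bin0 muln1 (eq_bigr (fun=> 1)) ?sum1_card // => u _; rewrite bin0.
apply: leq_trans (leq_mul_bin s_gt0 (subset_leq_card GX)) _.
rewrite -sum_nat_const [leqLHS]big_mkcond [leqRHS]big_mkcond /=.
apply: leq_sum => u _; case: ifP => // uG.
by rewrite (subsetP GX) // uG.
Qed.

(** A leaf outside [X] would lie below any leaf in [X], so the leaves are all inside or all outside
    [X]. *)
Lemma leq_stars_top e D X :
  0 < l -> X \subset maximals e D ->
  (forall x y, x \in D :\: X -> y \in X -> e x y) ->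
  #|stars e D| <= #|stars e (D :\: X)| + #|D :\: X| * 'C(#|X|, l).
Proof.
move=> l_gt0 /subsetP XM below.
rewrite -cards_draws -cardsX; apply: leq_trans (leq_card_setU _ _).
apply/subset_leq_card/subsetP => -[z A] /starsP[zD AD cA acA eA].
have zR : z \in D :\: X.
  rewrite inE zD andbT; apply/negP => /XM/maximalsP[_ zmax].
  have /card_gt0P[x xA] : 0 < #|A| by rewrite cA.
  by have := eA x xA; rewrite zmax // (subsetP AD).
rewrite inE; have [AX0|[x]] := set_0Vmem (A :&: X).
  apply/orP; left; apply/starsP; split=> //.
  by rewrite subsetD AD /= -setI_eq0 AX0.
move=> /setIP[xA xX]; apply/orP; right; rewrite inE /= zR inE cA eqxx andbT.
apply/subsetP => y yA; apply/negPn/negP => yX.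
by have := acA y x yA xA; rewrite below // inE yX (subsetP AD).
Qed.

(** Induction on [#|D|], then on the number of nonmaximal points. [F] stands for [M l]; its
    hypothesis turns the bound for [D :\: X] into [F #|D :\: X|]. *)
Lemma stars_bound (F : nat -> nat) e D :
  0 < l -> (forall k n, k < n -> F k + k * 'C(n - k, l) <= F n) ->
  irreflexive e -> transitive e -> 0 < #|D| ->
  exists2 k, k < #|D| & #|stars e D| <= F k + k * 'C(#|D| - k, l).
Proof.
move=> l_gt0 F_ge.
have [c] := ubnP #|D|; elim: c => // c IHc in e D *; rewrite ltnS => le_Dc.
have [d] := ubnP (#|D| - #|maximals e D|).
elim: d => // d IHd in e *; rewrite ltnS => le_d e_irr e_tr D_gt0.
set X := maximals e D in le_d.
have XD : X \subset D by apply/subsetP => x /maximalsP[].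
have [x0 x0X] : exists x, x \in X.
  have /card_gt0P[y yD] := D_gt0.
  by have [x xD xmax] := exists_maximal e_irr e_tr yD; exists x; apply/maximalsP.
have [v vX le_v] := exists_collapse l_gt0 x0X; rewrite -/X in vX le_v.
have /maximalsP[vD vmax] := vX.
pose R := [set y in D :\: X | ~~ e y v].
(* If [R] is empty, all other points lie below the collapsed layer [X]: peel it off and let [k]
   count what remains. *)
have [R0|[y0 y0R]] := set_0Vmem R.
  have cR : #|D :\: X| = #|D| - #|X| by rewrite cardsDS.
  have X_gt0 : 0 < #|X| by apply/card_gt0P; exists v.
  have lt_RD : #|D :\: X| < #|D| by rewrite cR; lia.
  exists #|D :\: X| => //; apply: (leq_trans le_v).
  have := @leq_stars_top (collapse e X v) D X l_gt0 (maximals_collapse vX).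
  have -> : #|D| - #|D :\: X| = #|X| by rewrite cR subKn // subset_leq_card.
  move=> top; apply: (leq_trans (top _)).
    move=> x y xR yX; rewrite /collapse /= yX; have /setDP[xD /negPf xX] := xR.
    rewrite xX; apply/negPn/negP => nexv.
    by have := in_set0 x; rewrite -R0 inE xR nexv.
  rewrite leq_add2r; have [R'0|[y yR]] := set_0Vmem (D :\: X).
    rewrite R'0 (_ : stars _ set0 = set0) ?cards0 //.
    by apply/setP => w; rewrite !inE.
  have [|k lt_k le_k] := IHc (collapse e X v) (D :\: X) (leq_trans lt_RD le_Dc)
    (@collapse_irr e X v e_irr) (@collapse_tr e X v e_tr).
    by apply/card_gt0P; exists y.
  by apply: leq_trans le_k (F_ge _ _ lt_k).
(* A maximal point of [R] becomes maximal after the collapse: the twins of [v] are not above it, and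
   a point above it outside [X] would belong to [R]. *)
have [m mR mmax] := exists_maximal e_irr e_tr y0R.
have [mDX nemv] := setIdP mR; have [mD mX] := setDP mDX.
have lt_max : #|X| < #|maximals (collapse e X v) D|.
  apply/proper_card/properP; split; first exact: maximals_collapse.
  exists m => //; apply/maximalsP; split=> // y yD; rewrite /collapse /= (negPf mX).
  case: ifP => [_|yX]; first exact: negbTE.
  apply/negP => e_my; have : y \in R.
    by rewrite inE in_setD yX yD /=; apply: contra nemv; apply: e_tr.
  by move/mmax; rewrite e_my.
have [|k lt_k le_k] := IHd _ _ (@collapse_irr e X v e_irr) (@collapse_tr e X v e_tr) D_gt0.
  have : maximals (collapse e X v) D \subset D by apply/subsetP => x /maximalsP[].
  by move/subset_leq_card; lia.
by exists k => //; apply: leq_trans le_v le_k.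
Qed.

End Stars.

(** * Occurrences as stars *)


Definition perm_lt n (p : 'S_n) : rel 'I_n := fun i j => (i < j) && (p i < p j).

Lemma perm_lt_irr n (p : 'S_n) : irreflexive (perm_lt p).
Proof. by move=> i; rewrite /perm_lt ltnn. Qed.

Lemma perm_lt_tr n (p : 'S_n) : transitive (perm_lt p).
Proof.
move=> j i k /andP[ij pij] /andP[jk pjk].
by apply/andP; split; [apply: ltn_trans ij jk | apply: ltn_trans pij pjk].
Qed.

Lemma q_perm_lt l (i j : 'I_l.+1) :
  (q_perm l i < q_perm l j) = (j != ord0) && ((i == ord0) || (j < i)).
Proof.
have val_q (k : 'I_l.+1) : q_perm l k = (if k == ord0 then 0 else l.+1 - k) :> nat.
  rewrite permE /q_fun; case: ifP => [//|/negbT k0].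
  by rewrite inordK // ltn_subrL /= andbT lt0n; apply: k0.
rewrite !val_q -!val_eqE /=; have := ltn_ord i; have := ltn_ord j.
by move: (i : nat) (j : nat) => [|a] [|b] //=; lia.
Qed.

Section Occurrences.

Variables (l n : nat) (p : 'S_n).

Lemma occurrenceP (f : {ffun 'I_l.+1 -> 'I_n}) :
  reflect [/\ forall i j : 'I_l.+1, i < j -> f i < f j,
              forall i : 'I_l.+1, i != ord0 -> p (f ord0) < p (f i)
            & forall i j : 'I_l.+1, i != ord0 -> i < j -> p (f j) < p (f i)]
          (f \in occurrences (q_perm l) p).
Proof.
rewrite inE; apply: (iffP andP) => [[/forallP H1 /forallP H2]|[H1 H2 H3]].
  split=> [i j|i i0|i j i0 lt_ij].
  - by have /forallP/(_ j)/implyP := H1 i.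
  - by have /forallP/(_ i)/eqP -> := H2 ord0; rewrite q_perm_lt i0 eqxx.
  - by have /forallP/(_ i)/eqP -> := H2 j; rewrite q_perm_lt i0 lt_ij orbT.
split; apply/forallP => i; apply/forallP => j; first exact/implyP/H1.
rewrite q_perm_lt; apply/eqP.
have [->|j0] := eqVneq j ord0 => /=.
  have [->|i0] := eqVneq i ord0; first by rewrite ltnn.
  by rewrite ltnNge ltnW ?H2.
have [->|i0] /= := eqVneq i ord0; first exact: H2.
case: (ltngtP i j) => ij.
- by rewrite ltnNge ltnW ?H3.
- exact: H3.
- by rewrite (val_inj ij) ltnn.
Qed.

(** The first position is the centre and the others are the leaves: their decreasing entries make
    them an antichain. *)
Definition star_of (f : {ffun 'I_l.+1 -> 'I_n}) := (f ord0, f @: [set~ ord0]).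

Let lt_pos : rel 'I_n := fun i j => i < j.

(** A strictly increasing map is determined by its image, here the centre and the leaves. *)
Lemma star_of_inj : {in occurrences (q_perm l) p &, injective star_of}.
Proof.
move=> f g /occurrenceP[f_lt _ _] /occurrenceP[g_lt _ _] [fg0 /setP fgS].
have lt_tr : transitive lt_pos by move=> j i k; apply: ltn_trans.
have lt_irr : irreflexive lt_pos by move=> i; apply: ltnn.
have sorted_ord : sorted (fun i j : 'I_l.+1 => i < j) (enum 'I_l.+1).
  by have := iota_ltn_sorted 0 l.+1; rewrite -val_enum_ord sorted_map.
have sorted_codom (h : {ffun 'I_l.+1 -> 'I_n}) :
    (forall i j : 'I_l.+1, i < j -> h i < h j) -> sorted lt_pos (codom h).
  by move=> h_lt; apply: homo_sorted sorted_ord => i j; apply: h_lt.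
have mem_codom (h : {ffun 'I_l.+1 -> 'I_n}) x :
    (x \in codom h) = (x == h ord0) || (x \in h @: [set~ ord0]).
  apply/codomP/orP => [[i ->]|[/eqP->|/imsetP[i _ ->]]]; [|by exists ord0|by exists i].
  have [->|i0] := eqVneq i ord0; [by left|right].
  by apply: imset_f; rewrite !inE.
have eq_codom : codom f = codom g.
  apply: (irr_sorted_eq lt_tr lt_irr) (sorted_codom _ f_lt) (sorted_codom _ g_lt) _.
  by move=> x; rewrite !mem_codom fg0 fgS.
apply/ffunP => i; move: eq_codom; rewrite !codomE => /eq_in_map; apply.
by rewrite mem_enum.
Qed.

Lemma star_of_occurrences :
  star_of @: occurrences (q_perm l) p = stars l (perm_lt p) [set: 'I_n].
Proof.
have ord_neq0 (i : 'I_l.+1) : i != ord0 -> ord0 < i by rewrite lt0n.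
apply/setP => -[z A]; apply/imsetP/starsP => [[f /occurrenceP[f_lt f_bot f_top] [-> ->]]|].
  have f_inj : injective f.
    by move=> i j; case: (ltngtP i j) => [/f_lt|/f_lt|/val_inj] // + eq_f; rewrite eq_f ltnn.
  split; rewrite ?inE ?subsetT //.
  - by rewrite card_imset // cardsC1 card_ord.
  - move=> _ _ /imsetP[i + ->] /imsetP[j _ ->]; rewrite !inE => i0.
    rewrite /perm_lt; case: (ltngtP i j) => [ij|/f_lt ij|/val_inj ->].
    + by have := f_top i j i0 ij; lia.
    + by lia.
    + by rewrite ltnn.
  - move=> _ /imsetP[i + ->]; rewrite !inE => i0.
    by rewrite /perm_lt f_lt ?f_bot ?ord_neq0.
(* Conversely, list the centre, then the leaves by increasing position; incomparability forces their
   entries to decrease. *)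
move=> [_ _ cA acA eA]; pose s := z :: enum A.
have size_s : size s = l.+1 by rewrite /= -cardE cA.
have lt_tr : transitive lt_pos by move=> j i k; apply: ltn_trans.
have sorted_s : sorted lt_pos s.
  rewrite /= (path_sortedE lt_tr); apply/andP; split.
    by apply/allP => x; rewrite mem_enum => /eA/andP[].
  rewrite /enum_mem; apply: (sorted_filter lt_tr).
  by rewrite -enumT; have := iota_ltn_sorted 0 n; rewrite -val_enum_ord sorted_map.
pose f := [ffun i : 'I_l.+1 => nth z s i].
have f_lt (i j : 'I_l.+1) : i < j -> f i < f j.
  move=> ij; rewrite !ffunE; apply: (sorted_ltn_nth lt_tr z sorted_s) => //;
    by rewrite inE size_s.
have f0 : f ord0 = z by rewrite ffunE.
have fA (i : 'I_l.+1) : i != ord0 -> f i \in A.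
  case: i => -[|i] //= lt_il _; rewrite ffunE /= -mem_enum mem_nth //.
  by rewrite -cardE cA.
exists f.
  apply/occurrenceP; split=> // [i /fA/eA|i j i0 lt_ij]; first by rewrite f0 => /andP[].
  have j0 : j != ord0 by rewrite -val_eqE /= -lt0n (leq_ltn_trans _ lt_ij).
  have := acA _ _ (fA i i0) (fA j j0); rewrite /perm_lt f_lt //= ltnNge => /negbFE.
  rewrite leq_eqVlt => /orP[/eqP/val_inj/perm_inj eq_f|//].
  by have := f_lt _ _ lt_ij; rewrite eq_f !ltnn.
rewrite /star_of f0; congr (_, _); apply/setP => x; apply/idP/imsetP => [xA|[i]].
  have lt_x : index x (enum A) < l by rewrite -[X in _ < X]cA cardE index_mem mem_enum.
  exists (Ordinal (lt_x : (index x (enum A)).+1 < l.+1)); first by rewrite !inE.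
  by rewrite ffunE /= nth_index ?mem_enum.
by rewrite !inE => /fA fiA ->.
Qed.

Lemma pattern_countE :
  pattern_count (q_perm l) p = #|stars l (perm_lt p) [set: 'I_n]|.
Proof. by rewrite -star_of_occurrences (card_in_imset star_of_inj). Qed.

End Occurrences.

(** * Appending a decreasing top layer *)

Section Append.

Variables (k r : nat) (p : 'S_k).

(** In the plot, this puts an antichain of [r] points above and to the right of all of [p]. *)
Definition append_fun (i : 'I_(k + r)) : 'I_(k + r) :=
  match split i with
  | inl j => lshift r (p j)
  | inr j => rshift k (rev_ord j)
  end.

Lemma append_funl i : append_fun (lshift r i) = lshift r (p i).
Proof. by rewrite /append_fun (unsplitK (inl i)). Qed.

Lemma append_funr i : append_fun (rshift k i) = rshift k (rev_ord i).
Proof. by rewrite /append_fun (unsplitK (inr i)). Qed.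

Lemma append_fun_inj : injective append_fun.
Proof.
move=> i j; case: (split_ordP i) => i' ->; case: (split_ordP j) => j' ->.
- by rewrite !append_funl => /lshift_inj/perm_inj->.
- by rewrite append_funl append_funr => /eqP; rewrite eq_lrshift.
- by rewrite append_funl append_funr => /eqP; rewrite eq_rlshift.
- by rewrite !append_funr => /rshift_inj/rev_ord_inj->.
Qed.

Definition append_layer : 'S_(k + r) := perm append_fun_inj.

Lemma append_layer_ll i j :
  perm_lt append_layer (lshift r i) (lshift r j) = perm_lt p i j.
Proof. by rewrite /perm_lt !permE !append_funl. Qed.

Lemma append_layer_lr i j : perm_lt append_layer (lshift r i) (rshift k j).
Proof.
rewrite /perm_lt !permE append_funl append_funr /=.
by rewrite !ltn_addr.
Qed.

Lemma append_layer_rr i j :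
  perm_lt append_layer (rshift k i) (rshift k j) = false.
Proof.
rewrite /perm_lt !permE !append_funr /= !ltn_add2l.
by have := ltn_ord i; have := ltn_ord j; lia.
Qed.

(** Stars inside [p], and stars with centre in [p] and all leaves in the new layer, are told apart
    by any leaf. *)
Lemma stars_append l : 0 < l ->
  #|stars l (perm_lt p) [set: 'I_k]| + k * 'C(r, l) <=
  #|stars l (perm_lt append_layer) [set: 'I_(k + r)]|.
Proof.
move=> l_gt0.
have -> : k * 'C(r, l) = #|setX [set: 'I_k] [set A : {set 'I_r} | #|A| == l]|.
  by rewrite cardsX cardsT card_ord card_draws card_ord.
pose lf (w : 'I_k * {set 'I_k}) := (lshift r w.1, lshift r @: w.2).
pose rf (w : 'I_k * {set 'I_r}) := (lshift r w.1, @rshift k r @: w.2).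
have lf_inj : injective lf.
  by move=> [z A] [z' A'] [] /val_inj -> /(imset_inj (@lshift_inj _ _))->.
have rf_inj : injective rf.
  by move=> [z A] [z' A'] [] /val_inj -> /(imset_inj (@rshift_inj _ _))->.
rewrite -(card_imset _ lf_inj) -(card_imset _ rf_inj) -cardsUI.
set I := _ :&: _; have -> : I = set0.
  apply/setP => w; rewrite !inE; apply/negP => /andP[/imsetP[[z A] /starsP[_ _ cA _ _] ->]].
  have /card_gt0P[x xA] : 0 < #|A| by rewrite cA.
  move=> /imsetP[[z' B] _ [_ /setP/(_ (lshift r x))]]; rewrite imset_f //=.
  by move=> /esym/imsetP[y _ /eqP]; rewrite eq_lrshift.
rewrite cards0 addn0; apply/subset_leq_card/subsetP => _ /setUP[] /imsetP[[z A] + ->].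
  move=> /starsP[_ _ cA acA eA]; apply/starsP; split; rewrite ?inE ?subsetT //=.
  - by rewrite card_imset //; apply: lshift_inj.
  - move=> _ _ /imsetP[x xA ->] /imsetP[y yA ->].
    by rewrite append_layer_ll acA.
  - by move=> _ /imsetP[x xA ->]; rewrite append_layer_ll eA.
case/setXP=> _ /=; rewrite {1}inE => /eqP cA; apply/starsP; split; rewrite ?inE ?subsetT //=.
- by rewrite card_imset //; apply: rshift_inj.
- by move=> _ _ /imsetP[x xA ->] /imsetP[y yA ->]; rewrite append_layer_rr.
- by move=> _ /imsetP[x xA ->]; rewrite append_layer_lr.
Qed.

End Append.

(** * The recurrence for [M] *)

Lemma objective_leq_M l n k : 0 < l -> k <= n -> objective l n k <= M l n.
Proof.
move=> l_gt0 le_kn; rewrite /objective -{2}(subnKC le_kn).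
have [|p eqM] := @eq_bigmax 'S_k (pattern_count (q_perm l)).
  by apply/card_gt0P; exists 1%g.
rewrite {1}/M /max_count eqM.
apply: leq_trans (leq_bigmax (append_layer (n - k) p)).
by rewrite !pattern_countE stars_append.
Qed.

(** This is [stars_bound] at [F = M l]. Unlike in [is_maximizer], [k = 0] is allowed; its objective
    is 0. *)
Lemma M_leq_objective l n : 0 < l -> 0 < n -> exists2 k, k < n & M l n <= objective l n k.
Proof.
move=> l_gt0 n_gt0.
have [|p eqM] := @eq_bigmax 'S_n (pattern_count (q_perm l)).
  by apply/card_gt0P; exists 1%g.
rewrite /M /max_count eqM pattern_countE.
have F_ge k m : k < m -> M l k + k * 'C(m - k, l) <= M l m.
  by move=> /ltnW; apply: objective_leq_M.
have := @stars_bound _ l (M l) (perm_lt p) setT l_gt0 F_ge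
  (@perm_lt_irr _ p) (@perm_lt_tr _ p).
by rewrite cardsT card_ord; apply.
Qed.

Lemma M0 l : 0 < l -> M l 0 = 0.
Proof.
move=> l_gt0; apply/eqP; rewrite -leqn0; apply/bigmax_leqP => p _.
by rewrite leqn0 pattern_countE cards_eq0; apply/eqP/setP => -[[]].
Qed.

(** * Maximizers of the objective *)


Section Maximizers.

Variable l : nat.
Hypothesis hl : 2 <= l.

Let l_gt0 : 0 < l. Proof. exact: ltnW. Qed.

Lemma binSl n : 'C(n.+1, l) = 'C(n, l) + 'C(n, l.-1).
Proof. by rewrite -{1 2}(prednK l_gt0) binS. Qed.

Lemma mul_binl n : l * 'C(n, l) = (n - l.-1) * 'C(n, l.-1).
Proof. by rewrite -{1 2}(prednK l_gt0) mul_bin_left. Qed.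

Lemma M_small n : n <= l -> M l n = 0.
Proof.
have [m] := ubnP n; elim: m => // m IHm in n *; rewrite ltnS => le_nm le_nl.
case: (posnP n) => [->|n_gt0]; first exact: M0.
have [k lt_kn] := M_leq_objective l_gt0 n_gt0.
rewrite /objective (IHm k); try lia.
case: k lt_kn => [|k] lt_kn; first by rewrite mul0n leqn0 => /eqP.
by rewrite bin_small ?muln0; lia.
Qed.

Lemma M_homo : {homo M l : m n / m <= n}.
Proof.
apply: homo_leq => [//|m n p|n]; first exact: leq_trans.
exact: leq_trans (leq_addr _ _) (objective_leq_M l_gt0 (leqnSn n)).
Qed.

Lemma objectiveS n k :
  k <= n -> objective l n.+1 k = objective l n k + k * 'C(n - k, l.-1).
Proof. by move=> le_kn; rewrite /objective subSn // binSl mulnDr addnA. Qed.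

(** By induction [M l] is smaller below [m], so for [l < m] an optimal [j] is positive and leaves a
    top layer of at least [l] points; one more point there gains [j * 'C(m - j, l.-1) > 0]. *)
Lemma M_ltS m : l <= m -> M l m < M l m.+1.
Proof.
have [c] := ubnP m; elim: c => // c IHc in m *; rewrite ltnS => le_mc.
rewrite leq_eqVlt => /predU1P[<-|lt_lm].
  rewrite M_small //; apply: leq_trans (objective_leq_M l_gt0 (ltn0Sn l)).
  by rewrite /objective subSS subn0 binn addn1.
have [j lt_jm] := M_leq_objective l_gt0 (leq_ltn_trans (leq0n l) lt_lm).
have lt_M i : i < m -> M l i < M l m.
  move=> lt_im; apply: (@leq_trans (M l (maxn i l).+1)); last by apply: M_homo; lia.
  by apply: leq_trans (IHc (maxn i l) _ _); [rewrite ltnS M_homo // leq_maxl | lia | lia].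
have [lt_mj|le_mj] := ltnP (m - j) l.
  by rewrite /objective (bin_small lt_mj) muln0 addn0 leqNgt lt_M.
case: (posnP j) => [->|j_gt0] le_M.
  have := leq_trans (lt_M 0 (leq_ltn_trans (leq0n l) lt_lm)) le_M.
  by rewrite /objective M0.
apply: leq_ltn_trans le_M _.
apply: leq_trans (objective_leq_M l_gt0 (leqW (ltnW lt_jm))).
rewrite objectiveS; last exact: ltnW.
rewrite -{1}[objective l m j]addn0 ltn_add2l muln_gt0 j_gt0 bin_gt0.
by lia.
Qed.

Lemma M_lt i k : i < k -> l < k -> M l i < M l k.
Proof.
move=> lt_ik lt_lk; apply: leq_ltn_trans (M_homo _ : M l i <= M l k.-1) _.
  by lia.
by have := @M_ltS k.-1; rewrite prednK; [apply; lia | lia].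
Qed.

Lemma top_layer_size n k : l < n -> k < n -> M l n <= objective l n k -> l <= n - k.
Proof.
move=> lt_ln lt_kn le_M; rewrite leqNgt; apply/negP => lt_l; move: le_M.
by rewrite /objective bin_small // muln0 addn0 leqNgt M_lt.
Qed.

(* Compares the maximum with the words obtained by exchanging the top two
   layers, of sizes [a] and [b], or by moving one point between them. *)
Lemma maximizer_bound n k :
  l < n -> 0 < k < n -> objective l n k = M l n -> l * k <= n.+1.
Proof.
move=> lt_ln /andP[k_gt0 lt_kn] max_k.
have le_lb : l <= n - k by apply: top_layer_size; rewrite ?max_k.
case: k => [|[|k]] // in k_gt0 lt_kn max_k le_lb *; first by lia.
set b := n - k.+2 in le_lb.
have eb : n - k.+1 = b.+1 by lia.
have := objective_leq_M l_gt0 (ltnW (ltnW lt_kn)); rewrite -max_k /objective -/b eb binSl.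
have Cb_gt0 : 0 < 'C(b, l.-1) by rewrite bin_gt0; lia.
(* If [k.+2 <= l], the values of [M] vanish and comparison with [k.+1] suffices. *)
have := mul_binl b; have [le_kl|lt_lk] := leqP k.+2 l.
  rewrite !M_small //; last exact: ltnW.
  move: Cb_gt0; move: 'C(b, l.-1) 'C(b, l) => C1 C Cb_gt0 eqC le_C.
  have : l * k.+1 * C1 <= (b - l.-1) * C1 by rewrite -eqC; nia.
  by rewrite leq_pmul2r // mulnS; lia.
(* An optimal word has a lower part of size [i], a layer of size [a] and a top layer of size [b],
   with [n = i + a + b]. *)
have [i lt_ik] := M_leq_objective l_gt0 k_gt0.
set a := k.+2 - i => Mk; have le_la : l <= a by apply: top_layer_size.
have eqMk : M l k.+2 = M l i + i * 'C(a, l).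
  by apply/eqP; rewrite eqn_leq Mk (objective_leq_M l_gt0 (ltnW lt_ik)).
(* Optimality against exchanging the layers gives [b * 'C(a, l) <= a * 'C(b, l)], which fails for
   [b < a]. *)
have le_ab : a <= b.
  rewrite leqNgt; apply/negP => lt_ba.
  have lt_ib : i + b <= n by lia.
  have := objective_leq_M l_gt0 lt_ib; rewrite -max_k /objective -/b eqMk.
  have -> : n - (i + b) = a by lia.
  have := objective_leq_M l_gt0 (leq_addr b i); rewrite /objective addKn.
  have := @ltn_mul_bin b a l hl le_la _; rewrite lt_ba andbT => /(_ ltac:(lia)).
  have -> : k.+2 = i + a by lia.
  by rewrite !mulnDl; lia.
have := objective_leq_M l_gt0 (_ : i <= k.+1); rewrite -ltnS => /(_ lt_ik).
have ea : k.+1 - i = a.-1 by lia.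
have ek : k.+2 = i + a by lia.
rewrite eqMk /objective ea -{2}[a]prednK; last by lia.
rewrite binSl.
have := leq_bin2l l.-1 (_ : a.-1 <= b) => /(_ ltac:(lia)).
have := @leq_mul_bin a.-1 b l.-1 ltac:(lia) ltac:(lia).
have a_gt1 : 1 < a by lia.
move: Cb_gt0; move: 'C(b, l.-1) 'C(b, l) 'C(a.-1, l.-1) 'C(a.-1, l) => B B' A A'.
move=> B_gt0 ratio le_AB le_Mk1 eqB le_f.
(* Optimality against moving one point from the middle layer to the top. Weakening [A] to [B] here
   yields [la], hence [lA], which is then fed back into [move1]. *)
have move1 : k.+1 * B <= B' + i * A by nia.
have la : l * a.-1 <= b - l.-1.
  rewrite -(leq_pmul2r B_gt0) -eqB -mulnA leq_mul2l; apply/orP; right.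
  have : i * A <= i * B by rewrite leq_mul2l le_AB orbT.
  have -> : a.-1 = k.+1 - i by lia.
  by rewrite mulnBl; lia.
have lA : l * A <= B.
  rewrite -(@leq_pmul2l b); last by lia.
  apply: (@leq_trans (l * (a.-1 * B))); first by rewrite mulnCA leq_mul2l ratio orbT.
  by rewrite mulnA leq_mul2r; lia.
have : l * k.+1 * B <= (b - l.-1 + i) * B.
  rewrite -mulnA mulnDl -eqB; apply: leq_trans (leq_mul (leqnn l) move1) _.
  by rewrite mulnDr leq_add2l mulnCA leq_mul2l lA orbT.
by rewrite leq_pmul2r // !mulnS; lia.
Qed.

(** * The largest maximizer *)

Lemma is_maximizerE n k :
  1 < n -> is_maximizer l n k = (0 < k < n) && (objective l n k == M l n).
Proof.
move=> n_gt1; rewrite /is_maximizer; have [/andP[k_gt0 lt_kn]|//] := boolP (0 < k < n).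
rewrite eqn_leq objective_leq_M ?(ltnW lt_kn) //=; apply/forall_inP/idP => [max_k|le_M j _].
  have [[|j] lt_jn le_M] := M_leq_objective l_gt0 (ltnW n_gt1).
    by apply: leq_trans le_M _; rewrite /objective M0.
  exact: leq_trans le_M (max_k (Ordinal lt_jn) _).
exact: leq_trans (objective_leq_M l_gt0 (ltnW (ltn_ord j))) le_M.
Qed.

Lemma k_maximizer n : 1 < n -> is_maximizer l n (k_ l n).
Proof.
move=> n_gt1; have [k lt_kn le_M] := M_leq_objective l_gt0 (ltnW n_gt1).
(* If the recurrence returns 0, then [M l n = 0] and 1 is optimal too. *)
have max_k : is_maximizer l n (maxn k 1).
  rewrite is_maximizerE // leq_max orbT /= gtn_max lt_kn n_gt1 /=.
  rewrite eqn_leq objective_leq_M //=; last by rewrite geq_max ltnW // ltnW.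
  apply: leq_trans le_M _; case: k lt_kn => [|k] lt_kn; first by rewrite /objective M0.
  by rewrite (maxn_idPl _).
have lt_n : maxn k 1 < n by rewrite gtn_max lt_kn.
have [|i max_i] := @eq_bigmax_cond 'I_n (is_maximizer l n) val.
  by apply/card_gt0P; exists (Ordinal lt_n).
by rewrite -[\max_(_ in _) _]/(k_ l n) => ->; apply: max_i.
Qed.

Lemma k_P n : 1 < n -> (0 < k_ l n < n) /\ objective l n (k_ l n) = M l n.
Proof.
by move=> n_gt1; have := k_maximizer n_gt1;
  rewrite is_maximizerE // => /andP[? /eqP].
Qed.

Lemma k_lt_objective n j : k_ l n < j < n -> objective l n j < M l n.
Proof.
move=> /andP[lt_kj lt_jn]; have n_gt1 : 1 < n by lia.
rewrite ltn_neqAle objective_leq_M 1?ltnW // andbT; apply/negP => max_j.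
have max_j' : is_maximizer l n j by rewrite is_maximizerE // max_j lt_jn andbT; lia.
have := @leq_bigmax_cond 'I_n (is_maximizer l n) val (Ordinal lt_jn) max_j'.
by rewrite -[X in _ <= X]/(k_ l n) /= leqNgt lt_kj.
Qed.

Lemma k_bound n : l < n -> l * k_ l n <= n.+1.
Proof.
by move=> lt_ln; have [|lt_k max_k] := @k_P n; [lia|apply: maximizer_bound].
Qed.

(** For [0 < i], passing from [i] to [i+1] multiplies the gain by [(i+1)(n-i-l+1) / (i(n-i))], which
    is at least 1 exactly when [l(i+1) <= n+1]. *)
Lemma gain_homo n k j :
  l * k <= n.+1 -> j <= k -> j * 'C(n - j, l.-1) <= k * 'C(n - k, l.-1).
Proof.
move=> le_lk le_jk; rewrite -(subnKC le_jk) in le_lk *.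
elim: (k - j) le_lk => [|d IHd]; first by rewrite addn0.
rewrite addnS => le_lk; apply: leq_trans (IHd _) _.
  by apply: leq_trans le_lk; rewrite leq_mul2l leqnSn orbT.
set i := j + d in le_lk *; have lt_in : i < n by nia.
rewrite -(leq_pmul2l (_ : 0 < n - i)) ?subn_gt0 //.
have -> : (n - i) * (i.+1 * 'C(n - i.+1, l.-1)) = i.+1 * (n - i - l.-1) * 'C(n - i, l.-1).
  by rewrite mulnCA subnS mul_bin_down mulnA.
rewrite mulnA leq_mul2r; apply/orP; right.
have : l * i.+1 = l.-1 * i.+1 + i.+1 by rewrite -{1}(prednK l_gt0) mulSn addnC.
by rewrite -subnDA mulnBr; nia.
Qed.

(** Otherwise the larger gain at [k_ l n] would make it a maximizer for [n.+1], beyond the largest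
    one. *)
Lemma k_leqS n : l < n -> k_ l n <= k_ l n.+1.
Proof.
move=> lt_ln; rewrite leqNgt; apply/negP => lt_k.
have [|/andP[_ lt_kn] max_k] := @k_P n; first by lia.
have [|/andP[_ lt_kn'] max_k'] := @k_P n.+1; first by lia.
have := @k_lt_objective n.+1 (k_ l n) ltac:(lia); rewrite -max_k'.
rewrite !objectiveS; try lia.
have := gain_homo (k_bound lt_ln) (ltnW lt_k).
have := objective_leq_M l_gt0 (_ : k_ l n.+1 <= n); rewrite max_k => /(_ ltac:(lia)).
lia.
Qed.

(** One term of Vandermonde's sum: exactly one element is taken among the first [s]. *)
Lemma mul_bin_leq s m r : s <= m -> s * 'C(m - s, r) <= 'C(m, r.+1).
Proof.
move=> le_sm; rewrite -{2}(subnKC le_sm) -Vandermonde.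
by rewrite (bigD1 (Ordinal (isT : 1 < r.+2))) //= bin1 subn1 leq_addr.
Qed.

(** For [l < m], put [t = k_ l m]; then [k_ l m.+2] is [t], [t+1] or [t+2]. Bounding [M l m.+1]
    below by the objective at [t], at both [t] and [t+1], or at [t+1] leaves respectively
    [t * 'C(m - t, l - 2)], ['C(m - t, l - 1)], or the second difference of [M] at [t < m]. *)
Lemma M_second_diff m :
  (forall n, l < n <= m.+1 -> k_ l n.+1 <= (k_ l n).+1) ->
  M l m.+2 + M l m <= (M l m.+1).*2 + 'C(m.+1, l.-1).
Proof.
have [c] := ubnP m; elim: c => // c IHc in m *; rewrite ltnS => le_mc kS.
have [|/andP[s_gt0 lt_s] Ms] := @k_P m.+2; first by [].
have f_le j : j <= m.+1 -> objective l m.+1 j <= M l m.+1 by apply: objective_leq_M.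
have [le_ml|lt_lm] := leqP m l.
  rewrite [M l m]M_small // addn0 -Ms.
  move: (k_ l m.+2) s_gt0 lt_s {Ms} => s s_gt0; rewrite ltnS leq_eqVlt.
  case/predU1P=> [->|lt_sm].
    by rewrite /objective subSnn bin_small // muln0; lia.
  rewrite objectiveS; last exact: ltnW.
  have := f_le s (ltnW lt_sm).
  suff : s * 'C(m.+1 - s, l.-1) <= 'C(m.+1, l.-1) by lia.
  have [s1|s_gt1] := leqP s 1; first by rewrite (_ : s = 1) ?mul1n ?leq_bin2l //; lia.
  (* For [s > 1] and [m <= l], the left side is nonzero only if [m = l] and [s = 2]. *)
  have [lt_ms|le_ms] := ltnP (m.+1 - s) l.-1; first by rewrite bin_small ?muln0.
  have -> : m = l by lia.
  have -> : s = 2 by lia.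
  have -> : l.+1 - 2 = l.-1 by lia.
  rewrite binn muln1.
  case: l hl => [|[|l']] // _; rewrite /= binS.
  by rewrite (@leq_add 1 1) // bin_gt0 ?leqnSn //; lia.
have [|/andP[t_gt0 lt_t] Mt] := @k_P m; first by lia.
have le_ts := leq_trans (k_leqS lt_lm) (k_leqS (leqW lt_lm)).
have le_st : k_ l m.+2 <= (k_ l m).+2.
  by apply: leq_trans (kS m.+1 _) _; rewrite ?leqnn ?andbT ?ltnS ?kS ?leqnSn ?andbT //; lia.
have l1 : l.-2.+1 = l.-1 by lia.
have binSl1 x : 'C(x.+1, l.-1) = 'C(x, l.-1) + 'C(x, l.-2) by rewrite -l1 binS.
rewrite -Ms -Mt; move: (k_ l m.+2) (k_ l m) {Ms Mt} s_gt0 lt_s t_gt0 lt_t le_ts le_st => s t.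
move=> s_gt0 lt_s t_gt0 lt_t le_ts le_st.
have [est|[est|est]] : s = t \/ s = t.+1 \/ s = t.+2 by lia.
- subst s; have := f_le t ltac:(lia); rewrite !objectiveS; try lia.
  rewrite subSn; last exact: ltnW.
  have := mul_bin_leq l.-2 (ltnW lt_t); rewrite l1.
  by have := leq_bin2l l.-1 (leqnSn m); rewrite (binSl1 (m - t)) mulnDr; lia.
- subst s; have := f_le t ltac:(lia); have := f_le t.+1 ltac:(lia).
  rewrite !objectiveS; try lia.
  rewrite subSS; have := leq_bin2l l.-1 (_ : m - t <= m.+1) => /(_ ltac:(lia)).
  by rewrite mulSn; lia.
subst s; have := f_le t.+1 ltac:(lia); rewrite /objective !subSS.
have := IHc t ltac:(lia) (fun n lt_n => kS n ltac:(lia)).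
have := leq_bin2l l.-1 (leqW lt_t).
by rewrite !mulSn; lia.
Qed.

Lemma k_leSk n : l < n -> k_ l n.+1 <= (k_ l n).+1.
Proof.
have [c] := ubnP n; elim: c => // c IHc in n *; rewrite ltnS => le_nc lt_ln.
rewrite leqNgt; apply/negP => lt_k.
have [|/andP[k_gt0 lt_kn] max_k] := @k_P n; first by lia.
have [|/andP[_ lt_jn] max_j] := @k_P n.+1; first by lia.
have := k_bound (leqW lt_ln); have := @k_lt_objective n.
move: (k_ l n.+1) (k_ l n) lt_k k_gt0 lt_kn max_k lt_jn max_j => j k.
move=> lt_kj k_gt0 lt_kn max_k lt_jn max_j lt_obj le_lj.
(* The increment from [objective l n i] to [objective l n.+1 i.+1] is at [i = k + d] at most what it
   is at [i = k]. *)
have step d : k + d < j ->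
    M l (k + d).+1 + 'C(n - (k + d), l) + M l k <= M l k.+1 + 'C(n - k, l) + M l (k + d).
  elim: d => [|d IHd]; first by rewrite addn0; lia.
  rewrite addnS => lt_dj; have le_2j : 2 * j <= n.+2.
    by apply: leq_trans le_lj; rewrite leq_mul2r hl orbT.
  have := IHd (ltnW lt_dj); set m := k + d in lt_dj *.
  have kS i : l < i <= m.+1 -> k_ l i.+1 <= (k_ l i).+1.
    by move=> /andP[lt_li le_im]; apply: IHc => //; lia.
  (* From [m] to [m.+1], ['C(n - m, l)] drops by ['C(n - m.+1, l.-1)], which absorbs the
     ['C(m.+1, l.-1)] of the second difference because [2 * j <= n.+2]. *)
  have := M_second_diff kS.
  rewrite (_ : n - m = (n - m.+1).+1) ?binSl; last by lia.
  by have := leq_bin2l l.-1 (_ : m.+1 <= n - m.+1) => /(_ ltac:(lia)); lia.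
have := step (j.-1 - k); rewrite subnKC; last by lia.
rewrite prednK; last by lia.
move=> /(_ ltac:(lia)).
(* By [step], [j.-1] would be a maximizer for [n] larger than [k]. *)
have := lt_obj j.-1 ltac:(lia); rewrite -max_k.
have := objective_leq_M l_gt0 (_ : k.+1 <= n.+1) => /(_ ltac:(lia)); rewrite -max_j.
case: j lt_kj lt_jn {max_j lt_obj le_lj step} => // j lt_kj lt_jn.
by rewrite /objective !subSS /= !mulSn; lia.
Qed.

(** Comparing [k = k_ l n] with [k.+1], where [M] does not decrease, gives ['C(n - k.+1, l) <= k *
    'C(n - k.+1, l.-1)], which bounds [n] linearly in [k]. *)
Lemma leq_k n : l < n -> n <= l.+1 * (k_ l n).+1.
Proof.
move=> lt_ln; rewrite leqNgt; apply/negP => lt_kn.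
have [|/andP[k_gt0 _] max_k] := @k_P n; first by lia.
move: (k_ l n) lt_kn k_gt0 max_k => k lt_kn k_gt0 max_k.
have lt_k : k.+1 < n by apply: leq_trans lt_kn; rewrite ltnS leq_pmull.
have := objective_leq_M l_gt0 (ltnW lt_k); rewrite -max_k /objective.
have -> : n - k = (n - k.+1).+1 by lia.
have := M_homo (leqnSn k); have := mul_binl (n - k.+1).
have : 0 < 'C(n - k.+1, l.-1) by rewrite bin_gt0; nia.
rewrite binSl; move: 'C(n - k.+1, l.-1) 'C(n - k.+1, l) => B B' B_gt0 eqB le_M le_f.
have le_B : B' <= k * B by nia.
have : (n - k.+1 - l.-1) * B <= l * k * B by rewrite -eqB -mulnA leq_mul2l le_B orbT.
by rewrite leq_pmul2r //; nia.
Qed.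

Lemma k_unbounded K n : l.+1 * K.+1 < n -> K < k_ l n.
Proof.
move=> lt_Kn; have lt_ln : l < n by nia.
have := leq_trans lt_Kn (leq_k lt_ln); rewrite ltn_pmul2l //.
Qed.

Lemma k_first : k_ l l.+1 = 1.
Proof.
have [|/andP[k_gt0 lt_k] max_k] := @k_P l.+1; first by lia.
have := @top_layer_size l.+1 (k_ l l.+1) (ltnSn l) lt_k.
by rewrite max_k leqnn => /(_ isT); lia.
Qed.

(** Discrete intermediate values: at the least [n] where the sequence reaches the target, the
    previous value is below it and the step is at most 1. *)
Lemma k_onto k : 0 < k -> exists2 n, l < n & k_ l n = k.
Proof.
case: k => // k _; elim: k => [|k [n0 _ _]]; first by exists l.+1; rewrite ?k_first.
have ex_n : exists n, (l < n) && (k.+1 < k_ l n).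
  exists (l.+1 * k.+2).+1; apply/andP; split; last exact: k_unbounded.
  by rewrite ltnS mulnS; lia.
have [n /andP[lt_ln lt_k] min_n] := ex_minnP ex_n.
exists n => //; apply/eqP; rewrite eqn_leq lt_k andbT.
case: n => // n in lt_ln lt_k min_n *; move: lt_ln; rewrite ltnS leq_eqVlt.
case/predU1P=> [eln|lt_ln]; first by rewrite -eln k_first in lt_k.
apply: leq_trans (k_leSk lt_ln) _; rewrite ltnS leqNgt; apply/negP => lt_k'.
by have := min_n n; rewrite lt_ln lt_k' ltnn => /(_ isT).
Qed.

End Maximizers.

Theorem theorem4p1 (l : nat) (hl : 2 <= l) :
  [/\ (* k_n tends to infinity *)
      forall K : nat, exists N : nat, forall n : nat, N <= n -> K <= k_ l n,
      forall n : nat, l.+1 <= n -> k_ l n <= k_ l n.+1 <= (k_ l n).+1,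
      k_ l l.+1 = 1
    & forall k : nat, 0 < k -> exists n : nat, 2 <= n /\ k_ l n = k].
Proof.
split=> [K|n lt_ln||k k_gt0].
- by exists (l.+1 * K.+1).+1 => n lt_n; apply/ltnW/k_unbounded.
- by rewrite k_leqS // k_leSk.
- exact: k_first.
by have [n lt_ln <-] := k_onto hl k_gt0; exists n; split=> //;
  apply: leq_trans hl (ltnW lt_ln).
Qed.
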